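(* If $\mathcal{I}$ is an ideal on $\mathbb{Q}\cap[0,1]$ with $\mathrm{conv}\subseteq\mathcal{I}\subseteq\mathrm{ctbl}$, then $\mathfrak{b}(\mathcal{I})=\mathfrak{b}_R(\mathcal{I})=\omega_1$. In particular, $\mathfrak{b}(\mathrm{conv})=\mathfrak{b}_R(\mathrm{conv})=\omega_1$, $\mathfrak{b}(\mathrm{ctbl})=\mathfrak{b}_R(\mathrm{ctbl})=\omega_1$, and $\mathfrak{b}(\mathrm{CB}_\alpha)=\mathfrak{b}_R(\mathrm{CB}_\alpha)=\omega_1$ for each countable ordinal $\alpha\geq2$.
   Context: An ideal on a countable infinite set $X$ is a nonempty family $\mathcal{I}\subseteq\mathcal{P}(X)$ closed under finite unions and under subsets, containing all finite subsets of $X$, and with $X\notin\mathcal{I}$; $\mathcal{I}^+=\mathcal{P}(X)\setminus\mathcal{I}$. Let $X=\mathbb{Q}\cap[0,1]$; closures are taken in $[0,1]$. $\mathrm{conv}=\{A\subseteq X: A\text{ has finitely many accumulation points in }[0,1]\}$, $\mathrm{ctbl}=\{A\subseteq X:|\overline{A}|\leq\omega\}$, and for a countable ordinal $\alpha$, $\mathrm{CB}_\alpha=\{A\subseteq X:(\overline{A})^{(\alpha)}=\emptyset\}$ where $(\cdot)^{(\alpha)}$ is the $\alpha$-th Cantor–Bendixson derivative in $[0,1]$. $\mathcal{D}_\mathcal{I}$ is the set of functions $f:X\to\omega$ with $f^{-1}(\{n\})\in\mathcal{I}$ for all $n$; $\mathfrak{b}(\mathcal{I})$ is the least cardinality of a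 family $\mathcal{F}\subseteq\mathcal{D}_\mathcal{I}$ such that for every $g\in\mathcal{D}_\mathcal{I}$ there is $f\in\mathcal{F}$ with $\{x: f(x)<g(x)\}\notin\mathcal{I}$. Families $\mathcal{A},\mathcal{B}$ are $\mathcal{I}$-orthogonal if $A\cap B\in\mathcal{I}$ for all $A\in\mathcal{A}$, $B\in\mathcal{B}$; $C$ $\mathcal{I}$-separates $(\mathcal{A},\mathcal{B})$ if $A\cap C\in\mathcal{I}$ and $B\setminus C\in\mathcal{I}$ for all $A\in\mathcal{A}$, $B\in\mathcal{B}$. An $\mathcal{I}$-gap is a pair $(\mathcal{A},\mathcal{B})$ of $\mathcal{I}$-orthogonal subfamilies of $\mathcal{I}^+$ not $\mathcal{I}$-separated by any set; an $\mathcal{I}$-$(\kappa,\lambda)$-gap has $|\mathcal{A}|=\kappa$, $|\mathcal{B}|=\lambda$. $\mathfrak{b}_R(\mathcal{I})$ is the least $\kappa$ such that there is an $\mathcal{I}$-$(\omega,\kappa)$-gap, and $\mathfrak{c}^+$ if none exists. *)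

(* Defs.v *)
From mathcomp Require Import all_boot all_order all_algebra.
From mathcomp Require Import all_classical all_reals all_analysis.

Set Implicit Arguments.
Unset Strict Implicit.
Unset Printing Implicit Defensive.

Import Order.TTheory GRing.Theory Num.Theory.
Import numFieldNormedType.Exports.

Local Open Scope classical_set_scope.
Local Open Scope card_scope.
Local Open Scope ring_scope.

Record is_ideal (T : Type) (I : set (set T)) : Prop := IsIdeal {
  ideal_nonempty : I !=set0;
  ideal_setU : forall A B, I A -> I B -> I (A `|` B);
  ideal_subset : forall A B, A `<=` B -> I B -> I A;
  ideal_finite : forall A, finite_set A -> I A;
  ideal_proper : ~ I [set: T] }.

Definition ideal_positive (T : Type) (I : set (set T)) : set (set T) := ~` I.

(* A cardinal is represented by any set K having that cardinality, compared
   with #<= and #=.  [least_card P K] reads: the least cardinality of a family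
   satisfying P exists and equals |K|. *)
Definition least_card (T U : Type) (P : set (set T)) (K : set U) : Prop :=
  (exists2 F, P F & F #= K) /\ (forall F, P F -> K #<= F).

(* |K| = |L|^+.  Every cardinal below |K| is that of a subset of K, so it is
   enough to test minimality of |K| on those. *)
Definition is_succ_card (T U : Type) (L : set T) (K : set U) : Prop :=
  [/\ L #<= K, ~ (K #<= L)
    & forall M : set U, M `<=` K -> ~ (M #<= L) -> K #<= M].

(* Countable ordinals, presented as strict well-orders of subsets of nat. *)
Record countable_ordinal := CountableOrdinal {
  co_dom : set nat;
  co_lt : nat -> nat -> Prop;
  co_field : forall x y, co_lt x y -> co_dom x /\ co_dom y;
  co_trans : forall x y z, co_lt x y -> co_lt y z -> co_lt x z;
  co_total : forall x y, co_dom x -> co_dom y ->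
    [\/ co_lt x y, x = y | co_lt y x];
  co_wf : well_founded co_lt }.

Definition ord_iso (a b : countable_ordinal) : Prop :=
  exists2 f : nat -> nat, set_bij (co_dom a) (co_dom b) f &
    forall x y, co_dom a x -> co_dom a y -> co_lt a x y <-> co_lt b (f x) (f y).

(* a <= b as ordinals: a embeds in b preserving the order. *)
Definition ord_le (a b : countable_ordinal) : Prop :=
  exists2 f : nat -> nat, (forall x, co_dom a x -> co_dom b (f x)) &
    forall x y, co_lt a x y -> co_lt b (f x) (f y).

Section FiniteOrdinal.
Variable n : nat.

Let lt (x y : nat) : Prop := (x < y < n)%N.

Let lt_field x y : lt x y -> `I_n x /\ `I_n y.
Proof. by move=> /andP[xy yn]; split => //; exact: ltn_trans xy yn. Qed.

Let lt_trans x y z : lt x y -> lt y z -> lt x z.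
Proof. by move=> /andP[xy _] /andP[yz zn]; rewrite /lt (ltn_trans xy yz). Qed.

Let lt_total x y : `I_n x -> `I_n y -> [\/ lt x y, x = y | lt y x].
Proof.
rewrite /lt /= => xn yn; case: (ltngtP x y) => [xy|yx|->].
- by apply: Or31; rewrite yn.
- by apply: Or33; rewrite xn.
- exact: Or32.
Qed.

Let lt_wf : well_founded lt.
Proof.
by elim/ltn_ind => y IH; constructor => x /andP[xy _]; exact: IH.
Qed.

Definition finite_ordinal : countable_ordinal :=
  CountableOrdinal lt_field lt_trans lt_total lt_wf.
End FiniteOrdinal.

(* The set of all countable ordinals, an ordinal being identified with an
   isomorphism class of well-orders. *)
Definition omega1 : set (set countable_ordinal) := range ord_iso.

Section Invariants.
Variables (T : Type) (I : set (set T)).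

Definition D_ideal : set (T -> nat) :=
  [set f | forall n, I (f @^-1` [set n])].

Definition unbounded_family (F : set (T -> nat)) : Prop :=
  F `<=` D_ideal /\
  forall g, D_ideal g -> exists2 f, F f & ~ I [set x | (f x < g x)%N].

(* b(I) = |K| *)
Definition is_b (U : Type) (K : set U) : Prop := least_card unbounded_family K.

Definition ideal_orthogonal (A B : set (set T)) : Prop :=
  forall a b, A a -> B b -> I (a `&` b).

Definition ideal_separates (C : set T) (A B : set (set T)) : Prop :=
  (forall a, A a -> I (a `&` C)) /\ (forall b, B b -> I (b `\` C)).

Definition ideal_gap (A B : set (set T)) : Prop :=
  [/\ A `<=` ideal_positive I, B `<=` ideal_positive I, ideal_orthogonal A B
    & ~ exists C, ideal_separates C A B].

Definition omega_gap_side (B : set (set T)) : Prop :=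
  exists2 A : set (set T), A #= [set: nat] & ideal_gap A B.

(* b_R(I) = |K|; the second alternative is the convention that b_R(I) is the
   successor of the continuum when there is no (omega, kappa)-gap. *)
Definition is_bR (U : Type) (K : set U) : Prop :=
  ((exists B, omega_gap_side B) /\ least_card omega_gap_side K) \/
  (~ (exists B, omega_gap_side B) /\ is_succ_card [set: set nat] K).

End Invariants.

Definition QI : Type := {q : rat | 0 <= q <= 1}.

Section IdealsOnQI.
Variable R : realType.

Definition QI_real (A : set QI) : set R := [set ratr (val q) | q in A].

(* For E included in [0, 1], these are the accumulation points and the closure
   of E in the space [0, 1]. *)
Definition acc01 (E : set R) : set R := limit_point E `&` `[0, 1].
Definition closure01 (E : set R) : set R := closure E `&` `[0, 1].

Definition conv_ideal : set (set QI) := [set A | finite_set (acc01 (QI_real A))].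

Definition ctbl_ideal : set (set QI) := [set A | countable (closure01 (QI_real A))].

Definition derived_set (F : set R) : set R := F `&` acc01 F.

(* The value at an ordinal of the Cantor-Bendixson recursion: S is the set of
   smaller ordinals and D gives the derivatives of F already computed on S.
   The clauses are those for zero, successor and limit ordinals; exactly one of
   them applies, and the other two hold vacuously. *)
Definition CB_step (lt : nat -> nat -> Prop) (F : set R) (S : set nat)
    (D : forall v, S v -> set R) : set R :=
  [set x |
    [/\ S = set0 -> F x,
        forall m (Sm : S m), (forall v, S v -> v = m \/ lt v m) ->
          derived_set (D m Sm) x
      & S !=set0 -> (forall v, S v -> exists2 w, S w & lt v w) ->
          forall v (Sv : S v), D v Sv x]].

(* The derivative of F of order {v | v < w}, for w in the domain of a. *)
Definition CB_below (a : countable_ordinal) (F : set R) : nat -> set R :=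
  Fix (@co_wf a) (fun=> set R)
    (fun w D => @CB_step (co_lt a) F [set v | co_lt a v w] D).

Definition CB_derivative (a : countable_ordinal) (F : set R) : set R :=
  @CB_step (co_lt a) F (co_dom a) (fun v _ => CB_below a F v).

Definition CB_ideal (a : countable_ordinal) : set (set QI) :=
  [set A | CB_derivative a (closure01 (QI_real A)) = set0].

Lemma CB_belowE (a : countable_ordinal) (F : set R) (w : nat) :
  CB_below a F w =
  @CB_step (co_lt a) F [set v | co_lt a v w] (fun v _ => CB_below a F v).
Proof.
rewrite /CB_below Fix_eq// => x f g fg; congr (CB_step _ _ _).
by apply: functional_extensionality_dep => v;
  apply: functional_extensionality_dep => vx; exact: fg.
Qed.

End IdealsOnQI.

(* Main.v *)
Require Import Defs.
From mathcomp Require Import all_boot all_order all_algebra.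
From mathcomp Require Import all_classical all_reals all_analysis.
From mathcomp Require Import wochoice lra.
Local Open Scope classical_set_scope.

(* Lower bounds hold for every ideal on a countable set: a countable family
   f_0, f_1, ... in D_I is bounded by x |-> min_i max (f_i x) i, and countable
   orthogonal families (a_n), (b_n) are separated by the union of the sets
   b_n \ (a_0 u ... u a_n).

   For the upper bounds, fix an injection x of omega1 into the reals, disjoint
   dense sets a_n of rationals, and an enumeration y_(c, n) of the points of
   [0, 1] that differ from x_c by a rational.  Choose sequences S_(c, n) in a_n
   converging to y_(c, n).  Let f_c take the value n on S_(c, n) and be injective
   elsewhere, and let b_c be the union of the S_(c, n).  If each P_n has countable
   closure, then for all but countably many c no y_(c, n) lies in the closure of
   P_n.  For such c, every set containing the points of S_(c, n) that are outside
   P_n, for all n, is dense in [0, 1], hence not in ctbl.  With P_n = {g <= n} this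
   shows that g does not bound (f_c), and with P_n = a_n n C that C does not
   separate (a_n) from (b_c).

   The Cantor-Bendixson derivatives of closed sets are closed and commute with
   finite unions, and each one removes only countably many points, so CB_a is an
   ideal between conv and ctbl. *)

Set Implicit Arguments.
Unset Strict Implicit.
Unset Printing Implicit Defensive.

Import Order.TTheory GRing.Theory Num.Theory.
Import numFieldNormedType.Exports.

Local Open Scope card_scope.

(** * Countable ordinals and omega1 *)

Lemma card_le_inj (T U : Type) (A : set T) (B : set U) (f : T -> U) :
  set_fun A B f -> set_inj A f -> A #<= B.
Proof.
move=> fAB finj; have /injfunPex[g] : exists2 f, set_fun A B f & set_inj A f.
  by exists f.
exact: inj_card_le.
Qed.

Lemma countableU (T : Type) (A B : set T) :
  countable A -> countable B -> countable (A `|` B).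
Proof.
move=> cA cB; rewrite -bigcup2E; apply: bigcup_countable => // -[|[|i]] _ //=.
Qed.

Lemma co_irr (a : countable_ordinal) x : ~ co_lt a x x.
Proof.
by elim/(well_founded_ind (@co_wf a)): x => x IH xx; exact: (IH x xx xx).
Qed.

Lemma co_asym (a : countable_ordinal) x y : co_lt a x y -> ~ co_lt a y x.
Proof. by move=> xy yx; exact: (co_irr (co_trans xy yx)). Qed.

Lemma ord_iso_refl a : ord_iso a a.
Proof. by exists id => //; split=> // x ax; exists x. Qed.

Lemma ord_iso_sym a b : ord_iso a b -> ord_iso b a.
Proof.
move=> [f [fab finj fsur] flt].
have /choice[g gP] : forall y, exists x, co_dom b y -> co_dom a x /\ f x = y.
  move=> y; have [/fsur[x ax <-]|nby] := pselect (co_dom b y); first by exists x.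
  by exists 0%N => /nby.
exists g.
  split=> [y /gP[]//|y z /set_mem by_ /set_mem bz gyz|x ax].
    by rewrite -(gP _ by_).2 gyz (gP _ bz).2.
  exists (f x); first exact: fab.
  have [agf fgf] := gP _ (fab _ ax).
  by apply: finj fgf; exact/mem_set.
move=> x y bx by_; have [ax fx] := gP _ bx; have [ay fy] := gP _ by_.
by rewrite (flt _ _ ax ay) fx fy.
Qed.

Lemma ord_iso_trans a b c : ord_iso a b -> ord_iso b c -> ord_iso a c.
Proof.
move=> [f [fab finj fsur] flt] [g [gbc ginj gsur] glt]; exists (g \o f).
  split=> [x /fab /gbc//|x y /set_mem ax /set_mem ay /= gfxy|z /gsur[y /fsur[x ax <-] <-]].
    by apply: finj; [exact/mem_set..|apply: ginj gfxy; exact/mem_set/fab].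
  by exists x.
move=> x y ax ay; rewrite (flt _ _ ax ay); apply: glt; exact: fab.
Qed.

Lemma ord_iso_class a b : ord_iso a b -> ord_iso a = ord_iso b.
Proof.
move=> ab; apply/seteqP; split=> c; last exact: ord_iso_trans.
by apply: ord_iso_trans; exact: ord_iso_sym.
Qed.

(** * A countable ordinal larger than each term of a sequence *)

Section SuccSum.
Variable A : nat -> countable_ordinal.

(** The points of the lexicographic sum of the [A n] get positive codes, which frees 0 to be a
    largest element above the sum. *)
Let code (p : nat * nat) : nat := (choice.pickle p).+1.

Let code_inj : injective code.
Proof. by move=> p q [] /(pcan_inj choice.pickleK). Qed.

Let pdom (p : nat * nat) : Prop := co_dom (A p.1) p.2.

Let plt (p q : nat * nat) : Prop :=
  (p.1 < q.1)%N \/ p.1 = q.1 /\ co_lt (A p.1) p.2 q.2.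

Let dom : set nat := [set k | k = 0%N \/ exists2 p, pdom p & k = code p].

Let lt (k l : nat) : Prop := exists2 p, pdom p & k = code p /\
  (l = 0%N \/ exists2 q, pdom q & l = code q /\ plt p q).

Let lt_field x y : lt x y -> dom x /\ dom y.
Proof.
move=> [p dp [-> pq]]; split; first by right; exists p.
by case: pq => [->|[q dq [-> _]]]; [left|right; exists q].
Qed.

Let plt_trans p q r : plt p q -> plt q r -> plt p r.
Proof.
case: p q r => [p1 p2] [q1 q2] [r1 r2]; rewrite /plt/=.
move=> [pq|[-> pq]] [qr|[<- qr]]; [left|left|left|right] => //.
  exact: ltn_trans qr.
by split=> //; exact: co_trans qr.
Qed.

Let lt_trans x y z : lt x y -> lt y z -> lt x z.
Proof.
move=> [p dp [-> pq]] [q dq [yq qr]]; exists p => //; split=> //.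
case: qr => [|[r dr [zr qr]]]; [by left|right].
exists r => //; split=> //; apply: plt_trans qr.
case: pq yq => [->//|[q' _ [-> pq']] /code_inj <-//].
Qed.

Let lt_total x y : dom x -> dom y -> [\/ lt x y, x = y | lt y x].
Proof.
move=> [->|[p dp ->]] [->|[q dq ->]].
- exact: Or32.
- by apply: Or33; exists q => //; split => //; left.
- by apply: Or31; exists p => //; split => //; left.
case: p q dp dq => [p1 p2] [q1 q2] dp dq.
have [pq|qp|pq] := ltngtP p1 q1.
- apply: Or31; exists (p1, p2) => //; split=> //; right; exists (q1, q2) => //.
  by split=> //; left.
- apply: Or33; exists (q1, q2) => //; split=> //; right; exists (p1, p2) => //.
  by split=> //; left.
subst q1; have [h|/= ->|h] := co_total dp dq.
- apply: Or31; exists (p1, p2) => //; split=> //; right; exists (p1, q2) => //.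
  by split=> //; right.
- exact: Or32.
- apply: Or33; exists (p1, q2) => //; split=> //; right; exists (p1, p2) => //.
  by split=> //; right.
Qed.

Let lt_wf : well_founded lt.
Proof.
have acc_code p : Acc lt (code p).
  case: p => n x; elim/ltn_ind: n x => n IHn x.
  elim/(well_founded_ind (@co_wf (A n))): x => x IHx.
  constructor=> k [[m z] _ [-> [//|[q _ [/code_inj <-]]]]].
  by rewrite /plt/= => -[/IHn//|[-> /IHx]].
move=> [|k]; constructor=> l [p _ [-> _]]; exact: acc_code.
Qed.

Definition succ_sum : countable_ordinal :=
  CountableOrdinal lt_field lt_trans lt_total lt_wf.

(** An isomorphism would yield an order-preserving map [h] of the whole order into its own summand
    [A n], so that [h 0] is below the top element 0. Well-foundedness forbids [h x] below [x]. *)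
Lemma succ_sum_not_iso n : ~ ord_iso succ_sum (A n).
Proof.
move=> [f [fdom _ _] flt]; pose h x := code (n, f x).
have dh x : dom x -> pdom (n, f x) by move=> /fdom.
have hlt x y : lt x y -> lt (h x) (h y).
  move=> xy; have [dx dy] := lt_field xy; exists (n, f x); first exact: dh.
  split=> //; right; exists (n, f y); first exact: dh.
  by split=> //; right; split=> //=; apply/flt.
have nh x : ~ lt (h x) x.
  by elim/(well_founded_ind lt_wf): x => x IH hx; exact: (IH _ hx (hlt _ _ hx)).
apply: (nh 0%N); exists (n, f 0%N); first by apply: dh; left.
by split=> //; left.
Qed.

End SuccSum.

(** If numbers coded the classes injectively, one sequence [A] would represent all of them,
    including that of [succ_sum A]. *)
Lemma omega1_uncountable : ~ countable omega1.
Proof.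
move=> /countable_injP[f finj].
have /choice[A AP] : forall n, exists a : countable_ordinal,
    (exists b, f (ord_iso b) = n) -> f (ord_iso a) = n.
  move=> n; have [[b <-]|nb] := pselect (exists b, f (ord_iso b) = n).
    by exists b.
  by exists (finite_ordinal 0) => /nb.
pose b := succ_sum A; pose n := f (ord_iso b).
apply: (@succ_sum_not_iso A n).
have fAn : f (ord_iso (A n)) = f (ord_iso b) by apply: AP; exists b.
rewrite -[ord_iso _](_ : ord_iso (A n) = _); first exact: ord_iso_refl.
by apply: finj fAn; apply/mem_set; eexists.
Qed.

(** * Embedding omega1 into an uncountable well-ordered set *)

Section Greedy.
Variables (U : choiceType) (K : set U) (u0 : U) (r : rel U).
Hypotheses (ncK : ~ countable K) (rwo : well_order r).

Let r_anti x y : r x y -> r y x -> x = y.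
Proof.
move=> xy yx; have := wo_chain_antisymmetric (withinW (A := predT) rwo).
by move=> /(_ x y isT isT); apply; rewrite xy yx.
Qed.

Let lst (A : set U) : U := xget u0 [set z | A z /\ forall x, A x -> r z x].

Let lstP (f : nat -> U) (S : set nat) (z := lst (K `\` f @` S)) :
  [/\ K z, forall y, S y -> f y <> z &
      forall u, K u -> (forall y, S y -> f y <> u) -> r z u].
Proof.
have [x Kx] : (K `\` f @` S) !=set0.
  apply: contra_notP ncK => /nonemptyPn KS.
  have {}KS : K `<=` f @` S by rewrite -setD_eq0.
  exact: sub_countable (subset_card_le KS) (sub_countable (card_image_le f S) _).
have [|w [[/set_mem Aw lbw] _]] := rwo (A := mem (K `\` f @` S)).
  by exists x; exact/mem_set.
have [|[Kz zS] lbz] := @xgetPex _ u0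
    [set z | (K `\` f @` S) z /\ forall x, (K `\` f @` S) x -> r z x].
  by exists w; split=> // y /mem_set; exact: lbw.
split=> // [y Sy fy|u Ku uS]; first by apply: zS; exists y.
by apply: lbz; split=> // -[y Sy fy]; exact: (uS y).
Qed.

(** Transfinite recursion that maps [a] onto an initial segment of [K]. *)
Let greedy (a : countable_ordinal) : nat -> U :=
  Fix (@co_wf a) (fun=> U) (fun x rec =>
    lst (K `\` [set u | exists y (yx : co_lt a y x), rec y yx = u])).

Let greedyE a x : greedy a x = lst (K `\` greedy a @` [set y | co_lt a y x]).
Proof.
rewrite {1}/greedy Fix_eq; first last.
  move=> {}x f g fg; congr (lst (_ `\` _)); apply/seteqP; split=> u /= [y [yx]].
    by rewrite fg; exists y, yx.
  by rewrite -fg; exists y, yx.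
congr (lst (_ `\` _)); apply/seteqP; split=> u /=.
  by move=> [y [yx <-]]; exists y.
by move=> [y yx <-]; exists y, yx.
Qed.

Let greedy_mono a x y : co_lt a x y ->
  r (greedy a x) (greedy a y) /\ greedy a x <> greedy a y.
Proof.
move=> xy; rewrite (greedyE a y).
have [Ky ny _] := lstP (greedy a) [set z | co_lt a z y].
split; last exact: ny.
rewrite {1}(greedyE a x); have [_ _] := lstP (greedy a) [set z | co_lt a z x].
by apply=> // z /= zx; apply: ny => /=; exact: co_trans xy.
Qed.

Let greedy_reflects a x y : co_dom a x -> co_dom a y ->
  r (greedy a x) (greedy a y) -> greedy a x <> greedy a y -> co_lt a x y.
Proof.
move=> ax ay xy nxy; have [//|xy'|/greedy_mono[yx _]] := co_total ax ay.
  by rewrite xy' in nxy.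
by case: nxy; exact: r_anti.
Qed.

Let greedy_inj a x y : co_dom a x -> co_dom a y ->
  greedy a x = greedy a y -> x = y.
Proof.
by move=> ax ay exy; have [/greedy_mono[]|//|/greedy_mono[_ []]] := co_total ax ay.
Qed.

Let next (a : countable_ordinal) : U := lst (K `\` greedy a @` co_dom a).

(* The greedy image of a is an initial segment of K, read off from its strict
   upper bound [next a]. *)
Let greedy_imageE a u : (greedy a @` co_dom a) u <->
  [/\ K u, r u (next a) & u <> next a].
Proof.
have [Kz nz lz] := lstP (greedy a) (co_dom a); split=> [[x ax <-]|[Ku ru nu]].
  split; last exact: nz.
    by rewrite greedyE; case: (lstP (greedy a) [set y | co_lt a y x]).
  rewrite (greedyE a x); have [_ _] := lstP (greedy a) [set y | co_lt a y x].
  by apply=> // y /= /co_field[ay _]; exact: nz.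
apply: contrapT => /= nau; apply: nu; apply: r_anti => //; apply: lz => // y ay yu.
by apply: nau; exists y.
Qed.

(** Equal bounds give equal greedy images; matching the points with the same image is an isomorphism
    because greedy maps preserve and reflect the order. *)
Let next_iso a b : next a = next b -> ord_iso a b.
Proof.
move=> nab.
have img u : (greedy a @` co_dom a) u <-> (greedy b @` co_dom b) u.
  by rewrite !greedy_imageE nab.
have /choice[f fP] : forall x, exists y,
    co_dom a x -> co_dom b y /\ greedy b y = greedy a x.
  move=> x; have [ax|nax] := pselect (co_dom a x); last by exists 0%N => /nax.
  have /img[y bY yx] : (greedy a @` co_dom a) (greedy a x) by exists x.
  by exists y.
exists f.
  split=> [x /fP[]//|x y /set_mem ax /set_mem ay fxy|y bY].
    by apply: (greedy_inj ax ay); rewrite -(fP _ ax).2 fxy (fP _ ay).2.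
  have /img[x ax xy] : (greedy b @` co_dom b) (greedy b y) by exists y.
  have [bfx fx] := fP _ ax.
  by exists x => //; apply: (greedy_inj bfx bY); rewrite fx.
move=> x y ax ay; have [bx fx] := fP _ ax; have [bY fy] := fP _ ay; split.
  by move=> /greedy_mono; rewrite -fx -fy => -[]; exact: greedy_reflects.
by move=> /greedy_mono; rewrite fx fy => -[]; exact: greedy_reflects.
Qed.

Lemma omega1_le_well_ordered : omega1 #<= K.
Proof.
have /choice[rep repP] : forall C, exists a, omega1 C -> ord_iso a = C.
  move=> C; have [[a _ <-]|nC] := pselect (omega1 C); first by exists a.
  by exists (finite_ordinal 0) => /nC.
apply: (@card_le_inj _ _ _ _ (next \o rep)) => [C _|C D /set_mem oC /set_mem oD /=].
  by have [] := lstP (greedy (rep C)) (co_dom (rep C)).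
by move=> /next_iso/ord_iso_class; rewrite !repP.
Qed.

End Greedy.

Lemma omega1_le_uncountable (U : Type) (K : set U) :
  ~ countable K -> omega1 #<= K.
Proof.
elim/Pchoice: U => U in K * => ncK.
have [r rwo] := well_ordering_principle U.
have [u _] : K !=set0 by apply: contra_notP ncK => /nonemptyPn ->.
exact: omega1_le_well_ordered u r ncK rwo.
Qed.

(** Common criterion for both invariants: an uncountable family has at least [omega1] members, and
    the witness, as an image of [omega1], has at most that many. *)
Lemma least_card_omega1 (X : Type) (P : set (set X)) (h : set countable_ordinal -> X) :
  (forall F, P F -> ~ countable F) -> P (h @` omega1) ->
  least_card P omega1.
Proof.
move=> Pnc Ph; split=> [|F /Pnc/omega1_le_uncountable//].
exists (h @` omega1) => //; apply: Cantor_Bernstein; first exact: card_image_le.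
exact/omega1_le_uncountable/Pnc.
Qed.

(** * Lower bounds *)

Lemma countable_enum (X : Type) (F : set X) (x0 : X) : countable F ->
  exists2 f : nat -> X, (forall n, F (f n) \/ f n = x0) &
    forall x, F x -> exists n, f n = x.
Proof.
move=> /countable_injP[c cinj].
have /choice[f fP] : forall n, exists x, (F x /\ c x = n) \/
    x = x0 /\ ~ exists2 x, F x & c x = n.
  move=> n; have [[x Fx cx]|nx] := pselect (exists2 x, F x & c x = n).
    by exists x; left.
  by exists x0; right.
exists f => [n|x Fx]; first by case: (fP n) => [[]|[]]; [left|right].
exists (c x); have [[Ff cf]|[_ []]] := fP (c x); last by exists x.
by apply: cinj cf; exact/mem_set.
Qed.

Section IdealTheory.
Variables (T : Type) (I : set (set T)).
Hypothesis idI : is_ideal I.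

Lemma ideal_set0 : I set0.
Proof. by apply: (ideal_finite idI). Qed.

Lemma ideal_bigcup_lt (A : nat -> set T) n :
  (forall i, (i < n)%N -> I (A i)) -> I [set x | exists2 i, (i < n)%N & A i x].
Proof.
elim: n => [|n IH] AI.
  by apply: (ideal_subset idI) ideal_set0 => x [].
apply: (@ideal_subset _ _ idI _ ([set x | exists2 i, (i < n)%N & A i x] `|` A n)).
  move=> x [i]; rewrite ltnS leq_eqVlt => /predU1P[->|ni] Aix; first by right.
  by left; exists i.
apply: (ideal_setU idI); last exact: AI.
by apply: IH => i ni; apply: AI; exact: ltnW.
Qed.

Lemma D_ideal_inj (c : T -> nat) : injective c -> D_ideal I c.
Proof.
move=> cinj n; apply: (ideal_finite idI).
have [[x cx]|nx] := pselect (exists x, c x = n); last first.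
  by rewrite (_ : _ @^-1` _ = set0)// -subset0 => x /= cx; apply: nx; exists x.
apply: (@sub_finite_set _ _ [set x]); last exact: finite_set1.
by move=> y /=; rewrite -cx => /cinj.
Qed.

Lemma D_ideal_le (f : T -> nat) n : D_ideal I f -> I [set x | (f x <= n)%N].
Proof.
move=> Df; apply: (ideal_subset idI) (ideal_bigcup_lt (n := n.+1) (fun i _ => Df i)).
by move=> x /= fx; exists (f x).
Qed.

(* A countable family f_0, f_1, ... is bounded by x |-> min_i max (f_i x) i. *)
Lemma unbounded_family_uncountable (c : T -> nat) (F : set (T -> nat)) :
  injective c -> unbounded_family I F -> ~ countable F.
Proof.
move=> cinj [FD unbF] /(countable_enum c)[f fF Ff].
have fD n : D_ideal I (f n).
  by have [/FD//|->] := fF n; exact: D_ideal_inj.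
(* The minimum over i of max (f_i x) i is encoded as the least [k] for which some [i <= k] has
   [f i x <= k]. *)
pose P x k := [exists i : 'I_k.+1, (f i x <= k)%N].
have exP x : exists k, P x k by exists (f 0 x); apply/existsP; exists ord0 => /=.
pose g x := ex_minn (exP x).
have gP x : exists2 i, (i < (g x).+1)%N & (f i x <= g x)%N.
  by rewrite /g; case: ex_minnP => k /existsP[i fi] _; exists i.
have g_min x i k : (i <= k)%N -> (f i x <= k)%N -> (g x <= k)%N.
  rewrite /g; case: ex_minnP => m _ mP ik fk; apply: mP; apply/existsP.
  by exists (Ordinal (ik : (i < k.+1)%N)).
have gD : D_ideal I g.
  move=> k; apply: (ideal_subset idI) (ideal_bigcup_lt (n := k.+1)
    (fun i _ => D_ideal_le k (fD i))) => x /= gx.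
  by have := gP x; rewrite gx.
have [h Fh] := unbF g gD; apply; have [n <-] := Ff _ Fh.
(* Where [n < f n x], the index [n] gives [g x <= f n x]; so [f n x < g x] forces [f n x <= n]. *)
apply: (ideal_subset idI) (D_ideal_le n (fD n)) => x /= fg.
rewrite leqNgt; apply/negP => nf.
by have := g_min x n _ (ltnW nf) (leqnn _); rewrite leqNgt fg.
Qed.

(** The separating set meets [a m] only inside the [b n] with [n < m], and leaves out of [b n] only
    points of the [a i] with [i <= n]. Either way finitely many intersections from [I] suffice. *)
Lemma ideal_gap_uncountable (A B : set (set T)) :
  countable A -> ideal_gap I A B -> ~ countable B.
Proof.
move=> /(countable_enum set0)[a aA Aa] [_ _ orth nsep] /(countable_enum set0)[b bB Bb].
have ab m n : I (a m `&` b n).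
  have [Aam|->] := aA m; last by rewrite set0I; exact: ideal_set0.
  have [Bbn|->] := bB n; last by rewrite setI0; exact: ideal_set0.
  exact: orth.
apply: nsep; exists [set x | exists2 n, b n x & forall i, (i < n.+1)%N -> ~ a i x].
split=> [_ /Aa[m <-]|_ /Bb[n <-]].
  apply: (ideal_subset idI) (ideal_bigcup_lt (n := m) (fun n _ => ab m n)).
  move=> x [amx [n bnx na]]; exists n => //.
  by rewrite ltnNge; apply/negP => mn; exact: (na m).
apply: (ideal_subset idI) (ideal_bigcup_lt (n := n.+1) (fun m _ => ab m n)).
move=> x [bnx /= nC]; apply: contrapT => na; apply: nC; exists n => // i ni aix.
by apply: na; exists i.
Qed.

End IdealTheory.

Local Open Scope ring_scope.

(** * Upper bounds *)

Section DyadicLevels.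

(** The rationals in [0, 1] of 2-adic valuation [-n]; they serve as the sets a_n of the gap. *)
Definition dyadic_level (n : nat) : set QI :=
  [set q | exists u v : nat,
    [/\ odd u, odd v & val q = u%:R / (v * 2 ^ n)%N%:R]].

Lemma dyadic_level_disjoint m n q :
  dyadic_level m q -> dyadic_level n q -> m = n.
Proof.
wlog mn : m n / (m <= n)%N => [H|].
  by move=> mq nq; have [/H->//|/ltnW/H->] := leqP m n.
move=> [u [v [ou ov qu]]] [u' [v' [ou' ov']]].
have pos k l : odd k -> ((k * 2 ^ l)%N%:R : rat) != 0.
  by move=> ok; rewrite pnatr_eq0 muln_eq0 negb_or expn_eq0/= andbT; case: k ok.
rewrite qu => /eqP; rewrite eqr_div ?pos// -!natrM eqr_nat.
rewrite -{1}(subnK mn) expnD !mulnA eqn_pmul2r ?expn_gt0//.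
have : (m + (n - m) = n)%N by rewrite subnKC.
(* With 2^m cancelled, a positive [n - m] would equate an even number with an odd one. *)
case: (n - m)%N => [|k]; first by rewrite addn0.
by move=> _ /eqP/(congr1 odd); rewrite expnS !oddM ou' ov andbF.
Qed.

Variable R : realType.

Lemma dyadic_level_dense n (x y : R) : 0 <= x -> x < y -> y <= 1 ->
  exists2 q, dyadic_level n q & x < ratr (val q) < y.
Proof.
(* The denominator [w] is made so large that (y - x) w > 3, which leaves room for an odd
   numerator. *)
move=> x0 xy y1; pose K := Num.bound (3 / (y - x)).
pose v := K.*2.+1; pose w := (v * 2 ^ n)%N; pose W : R := w%:R.
have yx0 : 0 < y - x by rewrite subr_gt0.
have w0 : (0 < w)%N by rewrite muln_gt0 expn_gt0.
have W0 : 0 < W by rewrite ltr0n.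
have W3 : 3 < (y - x) * W.
  rewrite mulrC -ltr_pdivrMr//; apply: (@lt_le_trans _ _ K%:R).
    by apply: archi_boundP; rewrite divr_ge0// ltW.
  rewrite ler_nat /w (@leq_trans v)//; last by rewrite leq_pmulr// expn_gt0.
  by rewrite /v -addnn -addnS leq_addr.
(* From 2t <= xW < 2t + 2, the odd number u = 2t + 3 satisfies xW < u <= xW + 3 < yW. *)
pose t := Num.trunc (x * W / 2); pose u := t.*2.+3.
have xW0 : 0 <= x * W / 2 by rewrite divr_ge0// mulr_ge0// ltW.
have /andP[t1 t2] := truncn_itv xW0; rewrite -/t in t1 t2.
have uE : u%:R = 2 * t%:R + 3 :> R.
  by rewrite /u -mul2n -addn3 natrD natrM.
have xu : x < u%:R / W by rewrite ltr_pdivlMr// uE; move: t2; rewrite -[t.+1%:R]natr1; lra.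
have uy : u%:R / W < y by rewrite ltr_pdivrMr// uE; lra.
have q01 : 0 <= (u%:R / w%:R : rat) <= 1.
  rewrite divr_ge0 ?ler0n//= ler_pdivrMr ?ltr0n// mul1r ler_nat.
  rewrite -(ler_nat R) -[leRHS]mul1r -ler_pdivrMr// ltW//.
  exact: lt_le_trans uy y1.
exists (exist (fun q : rat => 0 <= q <= 1) _ q01 : QI).
  exists u, v; split=> //=; first by rewrite odd_double.
  by rewrite odd_double.
by rewrite /= fmorph_div/= !ratr_nat xu uy.
Qed.

Lemma dyadic_level_approx n (y e : R) : 0 <= y <= 1 -> 0 < e ->
  exists2 q, dyadic_level n q & 0 < `|ratr (val q) - y| < e.
Proof.
(* The search interval lies to the left of [y] if [y = 1] and to the right otherwise; being open, it
   excludes [y]. *)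
move=> /andP[y0 y1] e0; move: y1; rewrite le_eqVlt => /predU1P[->|y1].
  have [||//|q nq /andP[q1 q2]] := @dyadic_level_dense n (Num.max 0 (1 - e)) 1.
  - by rewrite le_max lexx.
  - by rewrite gt_max ltr01/=; lra.
  exists q => //; move: q1; rewrite gt_max => /andP[_ q1].
  by rewrite ltr0_norm ?subr_lt0//; lra.
have [//|||q nq /andP[q1 q2]] := @dyadic_level_dense n y (Num.min 1 (y + e)).
- by rewrite lt_min y1/=; lra.
- by rewrite ge_min lexx.
exists q => //; move: q2; rewrite lt_min => /andP[_ q2].
by rewrite gtr0_norm ?subr_gt0//; lra.
Qed.

End DyadicLevels.

(** * Sequences converging to rational translates *)

Section Construction.
Variable R : realType.

Lemma itv01_uncountable : ~ countable (`[0, 1[%classic : set R).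
Proof.
move=> /countable_lebesgue_measure0; rewrite lebesgue_measure_itv/= lte_fin ltr01.
by rewrite oppr0 adde0 => /eqP; rewrite eqe oner_eq0.
Qed.

Lemma dense_not_ctbl (E : set QI) :
  `[0, 1[%classic `<=` closure (@QI_real R E) -> ~ ctbl_ideal R E.
Proof.
move=> dE; apply: contra_not itv01_uncountable; apply: sub_countable.
apply: subset_card_le => x x01; split; first exact: dE.
by move: x01; rewrite /= !in_itv/= => /andP[-> /ltW].
Qed.

Lemma dyadic_level_not_ctbl n : ~ ctbl_ideal R (dyadic_level n).
Proof.
apply: dense_not_ctbl => x; rewrite /= in_itv/= => /andP[x0 x1] B.
move=> /nbhs_ballP[e /= e0 eB].
have [|q nq /andP[_ qx]] := @dyadic_level_approx R n x e _ e0.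
  by rewrite x0 ltW.
exists (ratr (val q)); split; first by exists q.
by apply: eB; rewrite /ball/= distrC.
Qed.

(* The default value keeps every term both in x + Q and in [0, 1]. *)
Definition translate (x : R) (n : nat) : R :=
  let default := x - (Num.floor x)%:~R in
  if choice.unpickle n is Some q then
    if 0 <= x + ratr q <= 1 then x + ratr q else default
  else default.

Lemma translate01 x n : 0 <= translate x n <= 1.
Proof.
have d01 : 0 <= x - (Num.floor x)%:~R <= 1.
  by have := floor_itv x; rewrite intrD => /andP[? ?]; lra.
by rewrite /translate; case: choice.unpickle => // q; case: ifPn.
Qed.

Lemma translateE x n : exists q : rat, translate x n = x + ratr q.
Proof.
have dE : exists q : rat, x - (Num.floor x)%:~R = x + ratr q.
  by exists (- (Num.floor x)%:~R); rewrite rmorphN/= ratr_int.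
by rewrite /translate; case: choice.unpickle => // q; case: ifPn => // _; exists q.
Qed.

Lemma translate_dense x (z e : R) : 0 <= z < 1 -> 0 < e ->
  exists n, `|z - translate x n| < e.
Proof.
move=> /andP[z0 z1] e0.
have [|q] := @rat_in_itvoo R (z - x) (Num.min 1 (z + e) - x).
  by rewrite ltrD2r lt_min z1/=; lra.
rewrite in_itv/= => /andP[q1]; rewrite ltrBrDr lt_min => /andP[q2 q3].
exists (choice.pickle q); rewrite /translate choice.pickleK ifT; last by lra.
by rewrite distrC gtr0_norm; lra.
Qed.

(** A class [c] that fails has [xi c] in the countable set Z - Q, and [xi] is injective on the
    uncountable [omega1]. *)
Lemma translate_avoids (Z : set R) (xi : set countable_ordinal -> R) :
  set_inj omega1 xi -> countable Z ->
  exists2 c, omega1 c & forall n, ~ Z (translate (xi c) n).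
Proof.
move=> xinj Zc; apply: contrapT => nc; apply: omega1_uncountable.
pose Y := \bigcup_(q in [set: rat]) ((fun z => z - ratr q) @` Z).
apply: (@sub_countable _ _ _ Y).
  apply: (card_le_inj (f := xi)) => // c oc; apply: contrapT => nY.
  apply: nc; exists c => // n; have [q ->] := translateE (xi c) n => Zq.
  by apply: nY; exists q => //; exists (xi c + ratr q) => //; rewrite addrK.
apply: bigcup_countable => // q _.
exact: sub_countable (card_image_le _ _) Zc.
Qed.

Lemma dyadic_sequences : exists s : R -> nat -> nat -> QI, forall x n k,
  dyadic_level n (s x n k) /\
  0 < `|ratr (val (s x n k)) - translate x n| < k.+1%:R^-1.
Proof.
have /choice[s sP] (p : R * nat * nat) : exists q : QI,
    dyadic_level p.1.2 q /\
    0 < `|ratr (val q) - translate p.1.1 p.1.2| < p.2.+1%:R^-1.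
  have [|q] := @dyadic_level_approx R p.1.2 _ p.2.+1%:R^-1 (translate01 p.1.1 p.1.2).
    by rewrite invr_gt0.
  by exists q.
by exists (fun x n k => s (x, n, k)) => x n k; exact: (sP (x, n, k)).
Qed.

Lemma omega1_inj_real : exists xi : set countable_ordinal -> R, set_inj omega1 xi.
Proof.
have ncR : ~ countable [set: R].
  by apply: contra_not itv01_uncountable; apply: sub_countable; exact: card_leT.
by have /pcard_injP := omega1_le_uncountable ncR.
Qed.

Variable s : R -> nat -> nat -> QI.
Hypothesis sP : forall x n k, dyadic_level n (s x n k) /\
  0 < `|ratr (val (s x n k)) - translate x n| < k.+1%:R^-1.

Lemma range_conv x n : conv_ideal R (range (s x n)).
Proof.
apply: (@sub_finite_set _ _ [set translate x n]); last exact: finite_set1.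
move=> z [zl _] /=; apply: contrapT => /eqP zy.
(* A term within [d] of [z] is farther than [d] from the limit, which forces k + 1 < 1/d; so only
   finitely many terms are near [z]. *)
pose d := `|z - translate x n| / 2.
have d0 : 0 < d by rewrite divr_gt0// normr_gt0 subr_eq0.
have := (limit_point_infinite_setP _ _).1 zl _ (nbhsx_ballx z d d0); apply.
pose N := Num.bound d^-1.
apply: (@sub_finite_set _ _ [set ratr (val (s x n k)) | k in `I_N]); last first.
  exact/finite_image/finite_II.
move=> w [+ [q [k _ <-] wE]]; rewrite -{w}wE /= => dz; exists k => //=.
have [_ /andP[_ kd]] := sP x n k.
have dk : d < k.+1%:R^-1.
  apply: le_lt_trans kd; rewrite -(@lerD2l _ d); move: dz; rewrite /ball/=.
  have := ler_distD (ratr (val (s x n k))) z (translate x n); rewrite /d; lra.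
have {}dk : k.+1%:R < d^-1 :> R by rewrite -ltf_pV2 ?posrE ?ltr0n ?invr_gt0// invrK.
rewrite -ltnS -(ltr_nat R) (lt_trans dk)// (lt_le_trans (archi_boundP _))//.
  by rewrite invr_ge0 ltW.
by rewrite ler_nat.
Qed.

(** Some neighbourhood of [translate x n] misses [P n], so late terms of the sequence lie in [E] and
    the translate in its closure. The translates are dense. *)
Lemma approach_not_ctbl x (P : nat -> set QI) (E : set QI) :
  (forall n, ~ closure01 (@QI_real R (P n)) (translate x n)) ->
  (forall n k, ~ P n (s x n k) -> E (s x n k)) -> ~ ctbl_ideal R E.
Proof.
move=> yP PE; apply: dense_not_ctbl.
have yE n : closure (@QI_real R E) (translate x n).
  have y01 : `[0, 1]%classic (translate x n) by rewrite /= in_itv/= translate01.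
  have : ~ closure (@QI_real R (P n)) (translate x n) by move=> yc; exact: (yP n).
  move=> /existsNP[V /not_implyP[Vy nV]] U Uy.
  have /nbhs_ballP[e /= e0 eUV] : nbhs (translate x n) (U `&` V) by exact: filterI.
  have e0' : 0 <= e^-1 by rewrite invr_ge0 ltW.
  pose k := Num.bound e^-1; have [_ /andP[_ sk]] := sP x n k.
  have [Us Vs] : (U `&` V) (ratr (val (s x n k))).
    apply: eUV; rewrite /ball/= distrC (lt_trans sk)// invf_plt ?posrE//.
    by rewrite (lt_trans (archi_boundP e0'))// ltr_nat.
  exists (ratr (val (s x n k))); split=> //; exists (s x n k) => //.
  by apply: PE => Pn; apply: nV; exists (ratr (val (s x n k))); split=> //; exists (s x n k).
move=> z; rewrite /= in_itv/= => z01.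
have : closure (closure (@QI_real R E)) z.
  move=> U /nbhs_ballP[e /= e0 eU]; have [n nz] := translate_dense x z01 e0.
  by exists (translate x n); split; [exact: yE|exact: eU].
by rewrite -(closure_id _).1//; exact: closed_closure.
Qed.

End Construction.

(** * The values of b and b_R *)

Section Invariants.
Variables (R : realType) (I : set (set QI)).
Hypotheses (idI : is_ideal I) (convI : conv_ideal R `<=` I).
Hypothesis Ictbl : I `<=` ctbl_ideal R.

Let pick_inj : injective (choice.pickle : QI -> nat).
Proof. exact: (pcan_inj choice.pickleK). Qed.

Lemma is_b_omega1 : is_b I omega1.
Proof.
have [s sP] := dyadic_sequences R; have [xi xiinj] := omega1_inj_real R.
have sL x n k : dyadic_level n (s x n k) := (sP x n k).1.
(* The value [n] on the n-th sequence is unambiguous because the sequences lie in disjoint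
   levels. *)
have /choice[f fP] (x : R) : exists f : QI -> nat,
    (forall n k, f (s x n k) = n) /\
    forall q, (exists n, range (s x n) q) \/ f q = choice.pickle q.
  have /choice[f fP] (q : QI) : exists m : nat,
      (forall n, range (s x n) q -> m = n) /\
      ((exists n, range (s x n) q) \/ m = choice.pickle q).
    have [[n nq]|nn] := pselect (exists n, range (s x n) q); last first.
      by exists (choice.pickle q); split; [move=> n nq; case: nn; exists n|right].
    exists n; split; last by left; exists n.
    move=> m mq; have [[k _ kq] [l _ lq]] := (nq, mq).
    by apply: (@dyadic_level_disjoint _ _ q); [rewrite -kq|rewrite -lq]; exact: sL.
  exists f; split=> [n k|q]; last exact: (fP q).2.
  by apply: (fP _).1; exists k.
apply: (@least_card_omega1 _ _ (f \o xi)) => [F|].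
  exact: unbounded_family_uncountable pick_inj.
split=> [_ [c _ <-] n /=|g gD].
  set x := xi c.
  apply: (@ideal_subset _ _ idI _ (range (s x n) `|` choice.pickle @^-1` [set n])).
    move=> q /= fq; have [[m [k _ kq]]|] := (fP x).2 q; last by right; rewrite -fq.
    by left; exists k => //; rewrite -kq -fq -kq (fP x).1.
  apply: (ideal_setU idI); first by apply: convI; exact: range_conv.
  exact: (D_ideal_inj idI pick_inj).
(* On the n-th sequence [f (xi c)] equals [n], so it is below [g] at every term outside [P n]. *)
pose P n := [set q | (g q <= n)%N].
have Pc n : countable (closure01 (@QI_real R (P n))).
  by apply: Ictbl; exact: D_ideal_le.
have [c oc cP] := translate_avoids xiinj (bigcup_countable (countableP [set: nat])
  (fun n _ => Pc n)).
exists (f (xi c)); first by exists c.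
move=> /Ictbl; apply: (@approach_not_ctbl R s sP (xi c) P) => [n yn|n k nP].
  by apply: (cP n); exists n.
by rewrite /= (fP _).1 ltnNge; exact/negP.
Qed.

Lemma is_bR_omega1 : is_bR I omega1.
Proof.
have [s sP] := dyadic_sequences R; have [xi xiinj] := omega1_inj_real R.
have sL x n k : dyadic_level n (s x n k) := (sP x n k).1.
have level_card : range dyadic_level #= [set: nat].
  apply: inj_card_eq => m n _ _ mn.
  have [lm _] := sP 0 m 0%N; apply: (dyadic_level_disjoint lm).
  by rewrite -mn.
pose b x := \bigcup_n range (s x n).
have nc (B : set (set QI)) : omega_gap_side I B -> ~ countable B.
  move=> [A Anat]; apply: ideal_gap_uncountable => //.
  by rewrite (eq_countable Anat).
suff gap : omega_gap_side I ((b \o xi) @` omega1).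
  by left; split; [eexists; exact: gap|exact: (@least_card_omega1 _ _ (b \o xi))].
exists (range dyadic_level) => //; split.
- by move=> _ [n _ <-] /Ictbl; exact: dyadic_level_not_ctbl.
(* Positivity of [b (xi c)]: it contains all terms, so each [P n] may be empty. *)
- move=> _ [c _ <-] /Ictbl; apply: (@approach_not_ctbl R s sP (xi c) (fun=> set0)).
    by move=> n [+ _]; rewrite /QI_real image_set0 closure0.
  by move=> n k _; exists n => //; exists k.
(* Only the n-th sequence meets level [n], and its range is in conv. *)
- move=> _ _ [n _ <-] [c _ <-].
  apply: (ideal_subset idI) (convI (range_conv sP (xi c) n)) => q [nq [m _ [k _ kq]]].
  exists k => //; rewrite -kq; congr s; apply: dyadic_level_disjoint nq _.
  by rewrite -kq; exact: sL.
move=> [C [AC BC]].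
(* Separation puts each [P n] in [I], while the part of [b (xi c)] outside [C] keeps every term
   outside [P n]. *)
pose P n := dyadic_level n `&` C.
have Pc n : countable (closure01 (@QI_real R (P n))).
  by apply: Ictbl; apply: AC; exists n.
have [c oc cP] := translate_avoids xiinj (bigcup_countable (countableP [set: nat])
  (fun n _ => Pc n)).
have : I (b (xi c) `\` C) by apply: BC; exists c.
move=> /Ictbl; apply: (@approach_not_ctbl R s sP (xi c) P) => [n yn|n k nP].
  by apply: (cP n); exists n.
split; first by exists n => //; exists k.
by move=> Cs; apply: nP; split=> //; exact: sL.
Qed.

End Invariants.

(** * The ideals conv, ctbl and CB *)

Section LimitPoints.
Variable R : realType.
Implicit Types E F : set R.

Lemma limit_pointS E F : E `<=` F -> limit_point E `<=` limit_point F.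
Proof. by move=> EF x Ex U /Ex[y [? /EF ? ?]]; exists y. Qed.

Lemma limit_pointU E F : limit_point (E `|` F) `<=` limit_point E `|` limit_point F.
Proof.
move=> x EFx; apply: contrapT => /not_orP[].
rewrite !not_limit_pointE => -[U Ux EU] [V Vx FV].
have /EFx[y [yx [Ey|Fy] [Uy Vy]]] : nbhs x (U `&` V) by exact: filterI.
- by move: yx; rewrite (EU y)// eqxx.
- by move: yx; rewrite (FV y)// eqxx.
Qed.

Lemma closed_limit_point E : closed (limit_point E).
Proof. by apply: limit_point_closed; exact: hausdorff_accessible. Qed.

Lemma limit_point_closure E : limit_point (closure E) `<=` limit_point E.
Proof.
rewrite closure_isolated_limit_point => x /limit_pointU[|].
  by apply: limit_pointS; exact: isolatedS.
by move=> /subset_limit_point; exact: closed_limit_point.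
Qed.

Lemma limit_point_finite E : finite_set E -> limit_point E = set0.
Proof.
move=> finE; rewrite -subset0 => x /limit_point_infinite_setP/(_ _ filterT).
by apply; rewrite setTI.
Qed.

Lemma acc01S E F : E `<=` F -> acc01 E `<=` acc01 F.
Proof. by move=> EF x [Ex x01]; split => //; exact: limit_pointS Ex. Qed.

Lemma derived_setS E F : E `<=` F -> derived_set E `<=` derived_set F.
Proof. by move=> EF x [Ex Ax]; split; [exact: EF|exact: acc01S Ax]. Qed.

Lemma closed_derived_set E : closed E -> closed (derived_set E).
Proof.
move=> cE; apply: closedI => //; apply: closedI; first exact: closed_limit_point.
exact: itv_closed.
Qed.

(** A limit point of the union is one of [E] or of [F], and closedness puts it back in that same
    set. *)
Lemma derived_setU E F : closed E -> closed F ->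
  derived_set (E `|` F) `<=` derived_set E `|` derived_set F.
Proof.
move=> cE cF x [_ [/limit_pointU[] lx x01]]; [left|right]; split=> //.
- exact/cE/subset_limit_point.
- exact/cF/subset_limit_point.
Qed.

(** The removed points are isolated, and a set of reals has only countably many isolated points. *)
Lemma countable_setD_derived E : E `<=` `[0, 1] -> countable (E `\` derived_set E).
Proof.
move=> E01; apply: sub_countable (subset_card_le _) (@countable_isolated R E).
move=> x [Ex ndx]; have : closure E x by exact: subset_closure.
rewrite closure_isolated_limit_point => -[//|lx].
by case: ndx; split=> //; split=> //; exact: E01.
Qed.

End LimitPoints.

(** * Cantor-Bendixson derivatives *)

Section CantorBendixson.
Variables (R : realType) (a : countable_ordinal).
Implicit Types (F G : set R) (S : set nat).

Let step S F := @CB_step R (co_lt a) F S (fun v _ => CB_below a F v).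

(** Turns [CB_step] into a single formula in each of the cases zero, successor and limit. *)
Let step_cases S : S `<=` co_dom a ->
  [\/ S = set0 /\ forall F, step S F = F,
      exists m, [/\ S m, forall v, S v -> v = m \/ co_lt a v m &
        forall F, step S F = derived_set (CB_below a F m)]
    | [/\ S !=set0, forall v, S v -> exists2 w, S w & co_lt a v w &
        forall F, step S F = \bigcap_(v in S) CB_below a F v]].
Proof.
move=> Sa; have [->|/set0P S0] := eqVneq S set0.
  apply: Or31; split=> // F; apply/seteqP; split=> x; first by case=> + _ _; exact.
  by move=> Fx; split=> // -[].
have Sn0 : S <> set0 by move=> S0'; move: S0; rewrite S0' => -[].
have [[m Sm mmax]|nmax] :=
    pselect (exists2 m, S m & forall v, S v -> v = m \/ co_lt a v m).
  apply: Or32; exists m; split=> // F; apply/seteqP; split=> x.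
    by case=> _ /(_ m Sm mmax).
  move=> Dx; split=> // [m' Sm' m'max|_ /(_ m Sm)[w Sw mw]].
    suff -> : m' = m by [].
    have [//|m'm] := mmax _ Sm'; have [//|mm'] := m'max _ Sm.
    by case: (co_asym m'm mm').
  have [wm|/co_asym/(_ mw)//] := mmax _ Sw.
  by move: mw; rewrite wm => /co_irr.
have cof v : S v -> exists2 w, S w & co_lt a v w.
  move=> Sv; apply: contrapT => nw; apply: nmax; exists v => // w Sw.
  have [vw|->|] := co_total (Sa _ Sv) (Sa _ Sw); [|by left|by right].
  by case: nw; exists w.
apply: Or33; split=> // F; apply/seteqP; split=> x.
  by case=> _ _ /(_ S0 cof).
move=> Dx; split=> // m Sm mmax; case: nmax; exists m => //.
Qed.

Let step_decr S F v :
  S `<=` co_dom a ->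
  (forall u, S u -> co_lt a v u -> CB_below a F u `<=` derived_set (CB_below a F v)) ->
  S v -> step S F `<=` derived_set (CB_below a F v).
Proof.
move=> Sa dec Sv x; have [[S0]|[m [Sm mmax ->]]|[_ cof ->]] := step_cases Sa.
- by move: Sv; rewrite S0.
- have [->//|vm] := mmax _ Sv.
  by apply: derived_setS; apply: (subset_trans (dec _ Sm vm)) => y [].
- by have [w Sw vw] := cof _ Sv; move=> /(_ w Sw)/(dec _ Sw vw).
Qed.

Let seg w : [set v | co_lt a v w] `<=` co_dom a.
Proof. by move=> v /co_field[]. Qed.

Lemma CB_below_decr F v w : co_lt a v w ->
  CB_below a F w `<=` derived_set (CB_below a F v).
Proof.
elim/(well_founded_ind (@co_wf a)): w => w IH vw.
rewrite CB_belowE; apply: (step_decr (@seg w)) => // u uw vu; exact: IH.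
Qed.

Lemma CB_derivative_decr F v : co_dom a v ->
  CB_derivative a F `<=` derived_set (CB_below a F v).
Proof. by move=> av; apply: step_decr => // u _; exact: CB_below_decr. Qed.

Section Induction.
Variable P : (set R -> set R) -> Prop.
Hypothesis P0 : P id.
Hypothesis PS : forall D, P D -> P (fun F => derived_set (D F)).
(** At a limit the derivatives decrease; this is recorded as directedness, so that one index can
    replace two, as additivity requires. *)
Hypothesis Plim : forall S (D : nat -> set R -> set R), S !=set0 ->
  (forall v, S v -> P (D v)) ->
  (forall v w, S v -> S w ->
    exists2 u, S u & forall F, D u F `<=` D v F /\ D u F `<=` D w F) ->
  P (fun F => \bigcap_(v in S) D v F).

Let step_ind S : S `<=` co_dom a ->
  (forall v, S v -> P (CB_below a ^~ v)) -> P (step S).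
Proof.
move=> Sa PSv; have [[_ E]|[m [Sm _ E]]|[S0 _ E]] := step_cases Sa;
  rewrite (funext E).
- exact: P0.
- exact/PS/PSv.
apply: (@Plim S (fun v F => CB_below a F v)) => // v w Sv Sw.
have [vw|->|wv] := co_total (Sa _ Sv) (Sa _ Sw); [exists w|exists w|exists v] => // F.
- by split=> //; apply: (subset_trans (CB_below_decr vw)) => x [].
- by split.
- by split=> //; apply: (subset_trans (CB_below_decr wv)) => x [].
Qed.

Lemma CB_below_ind w : P (CB_below a ^~ w).
Proof.
elim/(well_founded_ind (@co_wf a)): w => w IH.
rewrite (funext (fun F => CB_belowE a F w)).
by apply: step_ind => //; exact: seg.
Qed.

Lemma CB_derivative_ind : P (CB_derivative a).
Proof. by apply: step_ind => // v _; exact: CB_below_ind. Qed.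

End Induction.

Lemma CB_below_sub F w : CB_below a F w `<=` F.
Proof.
move: F; apply: (CB_below_ind (P := fun D => forall F, D F `<=` F)) => [F x //|D DF F|S D].
  by apply: subset_trans (DF F) => x [].
by move=> [v Sv] DF _ F x /(_ v Sv); exact: DF.
Qed.

Lemma CB_derivativeS F G : F `<=` G -> CB_derivative a F `<=` CB_derivative a G.
Proof.
move: F G; apply: (CB_derivative_ind
    (P := fun D => forall F G, F `<=` G -> D F `<=` D G)) => [//|D DS F G FG|S D _ DS _].
  by apply: derived_setS; exact: DS.
by move=> F G FG x xD v Sv; apply: (DS v Sv F G FG); exact: xD.
Qed.

Lemma CB_derivativeU F G : closed F -> closed G ->
  CB_derivative a (F `|` G) `<=` CB_derivative a F `|` CB_derivative a G.
Proof.
(* Closedness is carried through the induction so that [derived_setU] applies at successors. *)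
suff [_] : (forall F, closed F -> closed (CB_derivative a F)) /\ forall F G,
  closed F -> closed G ->
  CB_derivative a (F `|` G) `<=` CB_derivative a F `|` CB_derivative a G by apply.
apply: (CB_derivative_ind (P := fun D => (forall F, closed F -> closed (D F)) /\
    forall F G, closed F -> closed G -> D (F `|` G) `<=` D F `|` D G)).
  by split=> // ? ? _ _ x.
  move=> D [Dc DU]; split=> [E cE|E E' cE cE']; first exact/closed_derived_set/Dc.
  apply: subset_trans (derived_setU (Dc _ cE) (Dc _ cE')).
  exact/derived_setS/DU.
move=> S D _ DP dir; split=> [E cE|E E' cE cE' x DU].
  by apply: closed_bigI => v Sv; exact: (DP v Sv).1.
(* If [x] is missing from [D v E] and from [D w E'], an index [u] whose derivatives lie inside both
   gives a contradiction. *)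
apply: contrapT => /not_orP[/existsNP[v /not_implyP[Sv nv]]].
move=> /existsNP[w /not_implyP[Sw nw]].
have [u Su uvw] := dir v w Sv Sw.
have [Dx|Dx] := (DP u Su).2 _ _ cE cE' _ (DU u Su).
- by apply: nv; exact: (uvw E).1.
- by apply: nw; exact: (uvw E').2.
Qed.

Lemma countable_setD_CB_derivative F : F `<=` `[0, 1] ->
  countable (F `\` CB_derivative a F).
Proof.
(* The inclusion in [F] keeps each derivative inside [0, 1], as [countable_setD_derived] demands. *)
move=> F01; suff [] : CB_derivative a F `<=` F /\
  countable (F `\` CB_derivative a F) by [].
apply: (CB_derivative_ind (P := fun D => D F `<=` F /\ countable (F `\` D F))).
- by split; [move=> x|rewrite setDv].
- move=> D [DF Dc]; split; first by apply: subset_trans DF => x [].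
  have cd : countable (D F `\` derived_set (D F)).
    by apply: countable_setD_derived; exact: subset_trans F01.
  apply: sub_countable (countableU Dc cd); apply: subset_card_le => x [Fx nx].
  by have [Dx|Dx] := pselect (D F x); [right|left].
move=> S D [v Sv] DP _; split; first by move=> x /(_ v Sv); exact: (DP v Sv).1.
(* Indices are natural numbers, so the set removed at a limit is a countable union. *)
rewrite (_ : _ `\` _ = \bigcup_(v in S) (F `\` D v F)).
  by apply: bigcup_countable => // w Sw; exact: (DP w Sw).2.
by rewrite setDE setC_bigcap setI_bigcupr; apply: eq_bigcupr => w _; rewrite setDE.
Qed.

End CantorBendixson.

(** * Ideal axioms and inclusions *)

Section Ideals.
Variable R : realType.

Lemma QI_realS (A B : set QI) : A `<=` B -> @QI_real R A `<=` QI_real B.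
Proof. exact: image_subset. Qed.

Lemma closure01S (E F : set R) : E `<=` F -> closure01 E `<=` closure01 F.
Proof. by move=> EF x [Ex x01]; split=> //; exact: closureS Ex. Qed.

Lemma closure01U (E F : set R) :
  closure01 (E `|` F) = closure01 E `|` closure01 F.
Proof. by rewrite /closure01 closureU setIUl. Qed.

Lemma closed_closure01 (E : set R) : closed (closure01 E).
Proof. by apply: closedI; [exact: closed_closure|exact: itv_closed]. Qed.

(** A closure consists of isolated points, always countably many, and accumulation points, here
    finitely many. *)
Lemma conv_sub_ctbl : conv_ideal R `<=` ctbl_ideal R.
Proof.
move=> A finA; apply: sub_countable (subset_card_le _)
  (countableU (@countable_isolated R (QI_real A)) (finite_set_countable finA)).
move=> x; rewrite /closure01 closure_isolated_limit_point => -[[ix|lx] x01].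
- by left.
- by right.
Qed.

Lemma ctbl_proper : ~ ctbl_ideal R setT.
Proof.
by apply: contra_not (@dyadic_level_not_ctbl R 0); apply: sub_countable;
  apply/subset_card_le/closure01S/QI_realS.
Qed.

Lemma finite_sub_conv (A : set QI) : finite_set A -> conv_ideal R A.
Proof.
move=> finA; rewrite /conv_ideal/= /acc01 limit_point_finite ?set0I//.
exact: finite_image.
Qed.

(** The lower bound supplies the finite sets and the upper bound properness. *)
Lemma ideal_between (I : set (set QI)) :
  conv_ideal R `<=` I -> I `<=` ctbl_ideal R ->
  (forall A B, I A -> I B -> I (A `|` B)) ->
  (forall A B, A `<=` B -> I B -> I A) -> is_ideal I.
Proof.
move=> cI Ic IU IS; split=> //; last by move=> /Ic; exact: ctbl_proper.
- by exists set0; apply/cI/finite_sub_conv.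
- by move=> A finA; exact/cI/finite_sub_conv.
Qed.

Lemma conv_is_ideal : is_ideal (conv_ideal R).
Proof.
apply: ideal_between => // [|A B cA cB|A B AB]; first exact: conv_sub_ctbl.
  apply: (@sub_finite_set _ _ (acc01 (@QI_real R A) `|` acc01 (@QI_real R B))).
    by move=> x; rewrite /QI_real image_setU => -[/limit_pointU[] ? ?]; [left|right].
  by rewrite finite_setU.
by apply: sub_finite_set; exact/acc01S/QI_realS.
Qed.

Lemma ctbl_is_ideal : is_ideal (ctbl_ideal R).
Proof.
apply: ideal_between => // [|A B cA cB|A B AB]; first exact: conv_sub_ctbl.
  by rewrite /ctbl_ideal/= /QI_real image_setU closure01U; exact: countableU.
by apply: sub_countable; exact/subset_card_le/closure01S/QI_realS.
Qed.

Variable a : countable_ordinal.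

(** An ordinal at least 2 takes at least two derivatives. The first lies in the finite set of
    accumulation points, since closing a set adds no limit points; the second is then empty. *)
Lemma conv_sub_CB : ord_le (finite_ordinal 2) a -> conv_ideal R `<=` CB_ideal R a.
Proof.
move=> [f _ flt] A finA; have f01 : co_lt a (f 0%N) (f 1%N) by exact: flt.
set F := closure01 (@QI_real R A); rewrite /CB_ideal/= -subset0.
have [_ a1] := co_field f01.
apply: (subset_trans (CB_derivative_decr (F := F) a1)).
apply: (@subset_trans _ (derived_set (derived_set F))).
  apply: derived_setS; apply: (subset_trans (CB_below_decr f01)).
  by apply: derived_setS; exact: CB_below_sub.
have finF : finite_set (derived_set F).
  apply: sub_finite_set finA => x [_ [lx x01]]; split=> //.
  by apply: limit_point_closure; apply: limit_pointS lx => y [].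
by move=> x [_ []]; rewrite limit_point_finite.
Qed.

(** An empty derivative means that the whole closure was removed, and only countably many points
    ever are. *)
Lemma CB_sub_ctbl : CB_ideal R a `<=` ctbl_ideal R.
Proof.
move=> A; rewrite /CB_ideal/= => A0.
have := @countable_setD_CB_derivative R a (closure01 (QI_real A)) (@subIsetr _ _ _).
by rewrite A0 setD0.
Qed.

Lemma CB_is_ideal : ord_le (finite_ordinal 2) a -> is_ideal (CB_ideal R a).
Proof.
move=> a2; apply: ideal_between => [||A B A0 B0|A B AB B0].
- exact: conv_sub_CB.
- exact: CB_sub_ctbl.
- rewrite /CB_ideal/= /QI_real image_setU closure01U -subset0.
  apply: (subset_trans (CB_derivativeU _ _)); [exact: closed_closure01..|].
  by rewrite A0 B0 setU0.
rewrite /CB_ideal/= -subset0 -B0; apply: CB_derivativeS.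
exact/closure01S/QI_realS.
Qed.

End Ideals.

Local Close Scope ring_scope.
Local Close Scope card_scope.

Theorem theorem6p3 (R : realType) :
  (forall I : set (set QI), is_ideal I -> conv_ideal R `<=` I -> I `<=` ctbl_ideal R ->
     is_b I omega1 /\ is_bR I omega1) /\
  [/\ is_b (conv_ideal R) omega1 /\ is_bR (conv_ideal R) omega1,
      is_b (ctbl_ideal R) omega1 /\ is_bR (ctbl_ideal R) omega1
    & forall a : countable_ordinal, ord_le (finite_ordinal 2) a ->
        is_b (CB_ideal R a) omega1 /\ is_bR (CB_ideal R a) omega1].
Proof.
have main (I : set (set QI)) : is_ideal I -> conv_ideal R `<=` I ->
    I `<=` ctbl_ideal R -> is_b I omega1 /\ is_bR I omega1.
  by move=> idI cI Ic; split; [exact: is_b_omega1 cI Ic|exact: is_bR_omega1 cI Ic].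
split=> //; split=> [||a a2]; apply: main => //.
- exact: conv_is_ideal.
- exact: conv_sub_ctbl.
- exact: ctbl_is_ideal.
- exact: conv_sub_ctbl.
- exact: CB_is_ideal.
- exact: conv_sub_CB.
- exact: CB_sub_ctbl.
Qed.
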